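(* Let $F$ be $\mu$-quasi-strongly monotone with $\mu>0$ and $\ell$-star-cocoercive, let $X^*=\{x^*\}$ be a singleton, and let $0<\gamma\le\frac1{6d\ell}$. Then for all $k\ge0$ the iterates produced by SEGA-SGDA satisfy $$\mathbb{E}\|x^k-x^*\|^2\le\left(1-\min\left\{\gamma\mu,\frac1{2d}\right\}\right)^kV_0,\qquad V_0=\|x^0-x^*\|^2+4d^2\gamma^2\sigma_0^2,$$ where $\sigma_0^2=\|h^0-F(x^* )\|^2$.
   Context: Norms and inner products on $\mathbb{R}^d$ are Euclidean. $F:\mathbb{R}^d\to\mathbb{R}^d$ is an operator and $R:\mathbb{R}^d\to\mathbb{R}\cup\{+\infty\}$ is a proper lower semicontinuous convex function. $X^*$ is the (nonempty) set of solutions of the regularized variational inequality: find $x^*\in\mathbb{R}^d$ with $\langle F(x^* ),x-x^*\rangle+R(x)-R(x^* )\ge0$ for all $x\in\mathbb{R}^d$. $\mathrm{proj}_{X^*}(x)=\arg\min_{y\in X^*}\|y-x\|$. For all $x\in\mathbb{R}^d$, with $x^*=\mathrm{proj}_{X^*}(x)$: $F$ is $\mu$-quasi-strongly monotone if $\langle F(x)-F(x^* ),x-x^*\rangle\ge\mu\|x-x^*\|^2$; $F$ is $\ell$-star-cocoercive ($\ell>0$) if $\|F(x)-F(x^* )\|^2\le\ell\langle F(x)-F(x^* ),x-x^*\rangle$. $[x]_j$ is the $j$-th component of $x$ and $e_1,\dots,e_d$ is the standard basis of $\mathbb{R}^d$. SEGA-SGDA, with deterministic $x^0\in\mathbb{R}^d$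 and $h^0=0$: at each iteration $k\ge0$ sample $j$ uniformly from $\{1,\dots,d\}$ (independently of the past) and set $$h^{k+1}=h^k+e_j([F(x^k)]_j-[h^k]_j),\quad g^k=d\,e_j([F(x^k)]_j-[h^k]_j)+h^k,\quad x^{k+1}=\mathrm{prox}_{\gamma R}(x^k-\gamma g^k),$$ where $\mathrm{prox}_{\gamma R}(x)=\arg\min_{y}\{R(y)+\|y-x\|^2/(2\gamma)\}$. *)

(* Defs.v *)
From HB Require Import structures.
From mathcomp Require Import all_boot all_order all_algebra.
From mathcomp Require Import all_classical all_reals all_analysis.

Set Implicit Arguments.
Unset Strict Implicit.
Unset Printing Implicit Defensive.

Import Order.TTheory GRing.Theory Num.Theory.
Import numFieldNormedType.Exports.

Local Open Scope classical_set_scope.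
Local Open Scope ring_scope.

(* The library norm on 'rV[R]_d is the sup norm, hence enorm; the topology is
   the same. *)
Definition dot (R : realType) (d : nat) (u v : 'rV[R]_d) : R :=
  \sum_(i < d) u 0 i * v 0 i.

Definition enorm (R : realType) (d : nat) (u : 'rV[R]_d) : R :=
  Num.sqrt (dot u u).

(* Arbitrary when f has no minimizer on A. *)
Definition argmin (R : realType) (T : pointedType) (A : set T)
    (f : T -> \bar R) : T :=
  get [set y | A y /\ forall z, A z -> (f y <= f z)%E].

Definition euclid_proj (R : realType) (d : nat) (A : set 'rV[R]_d) (x : 'rV[R]_d) :
    'rV[R]_d :=
  argmin A (fun y => (enorm (y - x))%:E).

(* This is prox_{gamma Reg}. *)
Definition prox (R : realType) (d : nat) (gamma : R) (Reg : 'rV[R]_d -> \bar R)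
    (x : 'rV[R]_d) : 'rV[R]_d :=
  argmin setT (fun y => Reg y + (enorm (y - x) ^+ 2 / (2 * gamma))%:E)%E.

Definition eproper (R : realType) (d : nat) (Reg : 'rV[R]_d -> \bar R) : Prop :=
  (forall x, (-oo < Reg x)%E) /\ (exists x, (Reg x < +oo)%E).

(* The convention 0 * +oo = 0 makes the cases t = 0 and t = 1 trivial. *)
Definition econvex (R : realType) (d : nat) (Reg : 'rV[R]_d -> \bar R) : Prop :=
  forall (x y : 'rV[R]_d) (t : R), 0 <= t <= 1 ->
    (Reg (t *: x + (1 - t) *: y)%R
       <= t%:E * Reg x + (1 - t)%:E * Reg y)%E.

(* Since +oo - +oo = -oo in \bar R, a solution has a finite value of Reg. *)
Definition VI_solutions (R : realType) (d : nat) (F : 'rV[R]_d -> 'rV[R]_d)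
    (Reg : 'rV[R]_d -> \bar R) : set 'rV[R]_d :=
  [set xs | forall x,
     (0 <= (dot (F xs) (x - xs))%:E + Reg x - Reg xs)%E].

Definition quasi_strongly_monotone (R : realType) (d : nat) (mu : R)
    (F : 'rV[R]_d -> 'rV[R]_d) (Xs : set 'rV[R]_d) : Prop :=
  forall x, let xs := euclid_proj Xs x in
    mu * enorm (x - xs) ^+ 2 <= dot (F x - F xs) (x - xs).

Definition star_cocoercive (R : realType) (d : nat) (l : R)
    (F : 'rV[R]_d -> 'rV[R]_d) (Xs : set 'rV[R]_d) : Prop :=
  forall x, let xs := euclid_proj Xs x in
    enorm (F x - F xs) ^+ 2 <= l * dot (F x - F xs) (x - xs).

(* One iteration on the pair (x^k, h^k) with sampled coordinate j;
   delta_mx 0 j is the basis vector e_j. *)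
Definition sega_step (R : realType) (d : nat) (F : 'rV[R]_d -> 'rV[R]_d)
    (Reg : 'rV[R]_d -> \bar R) (gamma : R) (s : 'rV[R]_d * 'rV[R]_d)
    (j : 'I_d) : 'rV[R]_d * 'rV[R]_d :=
  let: (x, h) := s in
  let g := (d%:R * (F x 0 j - h 0 j)) *: delta_mx 0 j + h in
  (prox gamma Reg (x - gamma *: g),
   h + (F x 0 j - h 0 j) *: delta_mx 0 j).

Fixpoint sega (R : realType) (d : nat) (F : 'rV[R]_d -> 'rV[R]_d)
    (Reg : 'rV[R]_d -> \bar R) (gamma : R) (x0 h0 : 'rV[R]_d)
    (j : nat -> 'I_d) (k : nat) : 'rV[R]_d * 'rV[R]_d :=
  if k is k'.+1 then sega_step F Reg gamma (sega F Reg gamma x0 h0 j k') (j k')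
  else (x0, h0).

Section Sampling.
Context (disp : measure_display) (T : measurableType disp) (R : realType).
Context (P : probability T R) (d : nat).

(* 'I_d carries its discrete sigma-algebra. *)
Definition discrete_rv (X : T -> 'I_d) : Prop :=
  forall A : set 'I_d, measurable (X @^-1` A).

Definition uniform_rv (X : T -> 'I_d) : Prop :=
  forall i, P (X @^-1` [set i]) = (d%:R^-1)%:E.

Definition mutually_independent (J : nat -> T -> 'I_d) : Prop :=
  forall (s : seq nat) (A : nat -> set 'I_d), uniq s ->
    P (\bigcap_(k in [set` s]) (J k @^-1` A k))
    = (\prod_(k <- s) P (J k @^-1` A k))%E.

Definition iid_uniform (J : nat -> T -> 'I_d) : Prop :=
  [/\ forall k, discrete_rv (J k),
      forall k, uniform_rv (J k)
    & mutually_independent J].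

End Sampling.

(* Main.v *)
Require Import Defs.
From HB Require Import structures.
From mathcomp Require Import all_boot all_order all_algebra.
From mathcomp Require Import all_classical all_reals all_analysis.
From mathcomp Require Import measurable_realfun ring lra.

(** The Lyapunov function V(x, h) = |x - xs|^2 + 4 d^2 gamma^2 |h - F(xs)|^2
    contracts by 1 - min(gamma mu, 1/(2d)) in mean over the sampled coordinate.
    Since xs = prox(xs - gamma F(xs)), the prox may be dropped when bounding
    |x^{k+1} - xs|; averaging |g - F(xs)|^2 and |h^{k+1} - F(xs)|^2 over the
    coordinate gives at most 2d(|a|^2 + |b|^2) and |a|^2/d + (1 - 1/d)|b|^2 with
    a = F(x) - F(xs) and b = h - F(xs). The |a|^2 terms add up to
    6 d gamma^2 |a|^2 <= gamma <a, x - xs> by star-cocoercivity and the step-size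
    bound, and the remaining -gamma <a, x - xs> contracts |x - xs|^2 by quasi-strong
    monotonicity. *)

Set Implicit Arguments.
Unset Strict Implicit.
Unset Printing Implicit Defensive.

Import Order.TTheory GRing.Theory Num.Theory.
Import numFieldNormedType.Exports.

Local Open Scope classical_set_scope.
Local Open Scope ring_scope.

(** * Algebra of the Euclidean inner product *)

Lemma dotC (R : realType) (d : nat) (u v : 'rV[R]_d) : dot u v = dot v u.
Proof. by apply: eq_bigr => i _; rewrite mulrC. Qed.

Lemma dotDl (R : realType) (d : nat) (u v w : 'rV[R]_d) :
  dot (u + v) w = dot u w + dot v w.
Proof. by rewrite /dot -big_split; apply: eq_bigr => i _; rewrite !mxE mulrDl. Qed.

Lemma dotZl (R : realType) (d : nat) (c : R) (u v : 'rV[R]_d) :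
  dot (c *: u) v = c * dot u v.
Proof. by rewrite /dot mulr_sumr; apply: eq_bigr => i _; rewrite !mxE mulrA. Qed.

Lemma dotNl (R : realType) (d : nat) (u v : 'rV[R]_d) : dot (- u) v = - dot u v.
Proof. by rewrite -scaleN1r dotZl mulN1r. Qed.

Lemma dotDr (R : realType) (d : nat) (u v w : 'rV[R]_d) :
  dot u (v + w) = dot u v + dot u w.
Proof. by rewrite dotC dotDl ![dot _ u]dotC. Qed.

Lemma dotZr (R : realType) (d : nat) (c : R) (u v : 'rV[R]_d) :
  dot u (c *: v) = c * dot u v.
Proof. by rewrite dotC dotZl dotC. Qed.

Lemma dotNr (R : realType) (d : nat) (u v : 'rV[R]_d) : dot u (- v) = - dot u v.
Proof. by rewrite dotC dotNl dotC. Qed.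

Definition dotE := (dotDl, dotDr, dotNl, dotNr, dotZl, dotZr).

Lemma dot_ge0 (R : realType) (d : nat) (u : 'rV[R]_d) : 0 <= dot u u.
Proof. by apply: sumr_ge0 => i _; rewrite -expr2 sqr_ge0. Qed.

Lemma sqr_coord_le_dot (R : realType) (d : nat) (u : 'rV[R]_d) (i : 'I_d) :
  u 0 i ^+ 2 <= dot u u.
Proof.
rewrite /dot (bigD1 i) //= -expr2 lerDl.
by apply: sumr_ge0 => j _; rewrite -expr2 sqr_ge0.
Qed.

Lemma dot_delta (R : realType) (d : nat) (u : 'rV[R]_d) (j : 'I_d) :
  dot u (delta_mx 0 j) = u 0 j.
Proof.
rewrite /dot (bigD1 j) //= mxE !eqxx mulr1 big1 ?addr0 // => i /negbTE ij.
by rewrite mxE ij andbF mulr0.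
Qed.

Lemma sqr_enorm (R : realType) (d : nat) (u : 'rV[R]_d) :
  enorm u ^+ 2 = dot u u.
Proof. by rewrite /enorm sqr_sqrtr // dot_ge0. Qed.

Lemma continuous_dot_sub (R : realType) (d : nat) (z : 'rV[R]_d) :
  continuous (fun y : 'rV[R]_d => dot (y - z) (y - z)).
Proof.
apply: continuous_big => [|i _]; first exact: add_continuous.
have -> : (fun y : 'rV[R]_d => (y - z) 0 i * (y - z) 0 i)
    = (fun y => (y 0 i - z 0 i) * (y 0 i - z 0 i)).
  by apply/funext => y; rewrite !mxE.
move=> p; change 'rV[R]_d in p.
have y_i : (fun y : 'rV[R]_d => y 0 i) @ nbhs p --> p 0 i.
  exact: (@coord_continuous R 1 d 0 i p).
have z_i : (fun _ : 'rV[R]_d => z 0 i) @ nbhs p --> z 0 i by exact: cvg_cst.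
exact: cvgM (cvgB y_i z_i) (cvgB y_i z_i).
Qed.

(** * Projection onto a singleton and solutions of the variational inequality *)

Lemma euclid_proj_set1 (R : realType) (d : nat) (a x : 'rV[R]_d) :
  euclid_proj [set a] x = a.
Proof.
rewrite /euclid_proj /argmin.
have /getPex[] // : exists y, [set y | [set a] y /\ forall z, [set a] z ->
    ((enorm (y - x))%:E <= (enorm (z - x))%:E)%E] y.
by exists a; split => // z ->.
Qed.

Lemma VI_solution_fin (R : realType) (d : nat) (F : 'rV[R]_d -> 'rV[R]_d)
    (Reg : 'rV[R]_d -> \bar R) (xs : 'rV[R]_d) :
  eproper Reg -> VI_solutions F Reg xs -> Reg xs \is a fin_num.
Proof.
move=> [Rgt [y Ry]] /(_ y); move: (Rgt xs); case: (Reg xs) => [r||] // _.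
by move: (Rgt y) Ry; case: (Reg y).
Qed.

(* The VI itself provides an affine minorant of Reg, so no separation theorem
   is needed for the existence of proximal points. *)
Lemma VI_solution_minorant (R : realType) (d : nat) (F : 'rV[R]_d -> 'rV[R]_d)
    (Reg : 'rV[R]_d -> \bar R) (xs y : 'rV[R]_d) :
  eproper Reg -> VI_solutions F Reg xs ->
  ((fine (Reg xs) + dot (- F xs) (y - xs))%:E <= Reg y)%E.
Proof.
move=> Rp Rxs; move: (VI_solution_fin Rp Rxs) (Rxs y).
case: (Reg xs) => [r||] // _; move: (Rp.1 y); case: (Reg y) => [s||] // _.
- by rewrite -EFinN -!EFinD !lee_fin dotNl /=; lra.
- by move=> _; exact: leey.
Qed.

(** * Existence of proximal points *)

(** Completing the square: the gap is |y - z + gamma b|^2 / (2 gamma). Together with an affine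
    minorant of [Reg] of slope [b], this bounds the prox objective from below. *)
Lemma half_sqr_minorant (R : realType) (d : nat) (gamma : R) (b u z y : 'rV[R]_d) :
  0 < gamma ->
  dot b (z - u) - gamma * dot b b / 2
    <= dot b (y - u) + dot (y - z) (y - z) / (2 * gamma).
Proof.
move=> gamma0.
have : 0 <= dot (y - z + gamma *: b) (y - z + gamma *: b) / (2 * gamma).
  by rewrite divr_ge0 ?dot_ge0 //; lra.
have -> : dot (y - z + gamma *: b) (y - z + gamma *: b) / (2 * gamma)
    = dot (y - z) (y - z) / (2 * gamma) + dot b (y - z) + gamma * dot b b / 2.
  move: (y - z) => w; rewrite !dotE (dotC w b); field; lra.
by rewrite !dotE; lra.
Qed.

Definition prox_obj (R : realType) (d : nat) (gamma : R) (Reg : 'rV[R]_d -> \bar R)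
    (z y : 'rV[R]_d) : \bar R :=
  (Reg y + (dot (y - z) (y - z) / (2 * gamma))%:E)%E.

(** Strong convexity: at the midpoint of [u] and [v] the objective lies at least |u - v|^2 / (8
    gamma) below the average of its two values, yet it cannot fall below [m]. Near-minimizers are
    therefore close together. *)
Lemma prox_obj_midpoint (R : realType) (d : nat) (gamma : R)
    (Reg : 'rV[R]_d -> \bar R) (z u v : 'rV[R]_d) (m a : R) :
  0 < gamma -> (forall x, (-oo < Reg x)%E) -> econvex Reg ->
  (forall y, (m%:E <= prox_obj gamma Reg z y)%E) ->
  (prox_obj gamma Reg z u < (m + a)%:E)%E ->
  (prox_obj gamma Reg z v < (m + a)%:E)%E ->
  dot (u - v) (u - v) < 8 * gamma * a.
Proof.
move=> gamma0 Rgt Rconv hm; rewrite /prox_obj => hu hv.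
have half01 : 0 <= (2^-1 : R) <= 1 by apply/andP; split; lra.
have := Rconv u v 2^-1 half01; have := hm (2^-1 *: u + (1 - 2^-1) *: v).
move: (Rgt u) hu; case Eu: (Reg u) => [ru||] // _.
move: (Rgt v) hv; case Ev: (Reg v) => [rv||] // _.
rewrite /prox_obj; rewrite -!EFinD !lte_fin.
set w := (_ *: u + _)%R.
case: (Reg w) (Rgt w) => [rw||] // _; rewrite -?EFinM -?EFinD ?lee_fin => hu hv hw hc.
have Ew : dot (w - z) (w - z) / (2 * gamma) =
    (dot (u - z) (u - z) / (2 * gamma) + dot (v - z) (v - z) / (2 * gamma)) / 2
    - dot (u - v) (u - v) / (8 * gamma).
  rewrite /w !dotE ![dot v u]dotC ![dot z _]dotC; field; lra.
rewrite Ew in hw.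
have : dot (u - v) (u - v) / (8 * gamma) < a.
  move: hu hv hw; set Q := dot (u - v) _ / _; lra.
rewrite ltr_pdivrMr; last lra.
by rewrite mulrC.
Qed.

(* By the midpoint estimate the sublevel sets of the strongly convex objective
   form a Cauchy filter; lower semicontinuity makes its limit a minimizer. *)
Lemma exists_prox (R : realType) (d : nat) (gamma : R)
    (Reg : 'rV[R]_d -> \bar R) (b u z : 'rV[R]_d) (r : R) :
  0 < gamma -> eproper Reg -> econvex Reg -> lower_semicontinuous Reg ->
  (forall y, ((r + dot b (y - u))%:E <= Reg y)%E) ->
  exists p, forall y, (prox_obj gamma Reg z p <= prox_obj gamma Reg z y)%E.
Proof.
move=> gamma0 [Rgt [y0 Ry0]] Rconv Rlsc Rmin.
(* Only the finite values of the objective are collected, so that the infimum is a real number. *)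
pose E := [set s : R | exists y, prox_obj gamma Reg z y = s%:E].
have hE : has_inf E.
  split.
    move: (Rgt y0) Ry0; case Er : (Reg y0) => [s||] // _ _.
    by exists (s + dot (y0 - z) (y0 - z) / (2 * gamma)), y0; rewrite /prox_obj Er.
  exists (r + (dot b (z - u) - gamma * dot b b / 2)) => t [y].
  have := Rmin y; rewrite /prox_obj; case: (Reg y) => [s||] //.
  rewrite lee_fin -EFinD => hs [<-].
  have := half_sqr_minorant b u z y gamma0; lra.
set m := inf E.
have hm y : (m%:E <= prox_obj gamma Reg z y)%E.
  case Ey : (prox_obj gamma Reg z y) => [s||]; last first.
  - by move: (Rgt y) Ey; rewrite /prox_obj; case: (Reg y).
  - by rewrite leey.
  - by rewrite lee_fin; apply: ge_inf; [case: hE|exists y].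
pose sub e := [set y | (prox_obj gamma Reg z y < (m + e)%:E)%E].
pose G := filter_from [set e : R | 0 < e] sub.
have GF : ProperFilter G.
  apply: filter_from_proper => [|e e0].
    apply: filter_from_filter; first by exists 1 => /=; exact: ltr01.
    move=> e1 e2 /= e10 e20; exists (Num.min e1 e2).
      by rewrite /= lt_min e10.
    move=> y /= hy; split; apply: (lt_le_trans hy);
      by rewrite lee_fin lerD2l ge_min lexx ?orbT.
  have [s [y Ey] hs] := inf_adherent e0 hE.
  by exists y; rewrite /sub /= Ey lte_fin.
have /cauchy_cvg : cauchy G.
  apply: cauchy_exP => e e0.
  (* With this gap [prox_obj_midpoint] gives |y - y'|^2 < e^2, so each coordinate of the difference
     is below [e], as the entrywise [ball] requires. *)
  have e20 : 0 < e ^+ 2 / (8 * gamma).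
    by rewrite divr_gt0 ?exprn_gt0 // mulr_gt0.
  have Ge : G (sub (e ^+ 2 / (8 * gamma))) by exists (e ^+ 2 / (8 * gamma)).
  have [y hy] := @filter_ex _ G GF _ Ge.
  exists y; exists (e ^+ 2 / (8 * gamma)) => // y' hy'; split => // i j.
  have := prox_obj_midpoint gamma0 Rgt Rconv hm hy hy'.
  rewrite [X in _ < X]mulrC divfK; last by lra.
  rewrite /ball /= => /(le_lt_trans (sqr_coord_le_dot _ j)).
  rewrite !mxE (ord1 i) -[X in X < _]real_normK ?num_real // => h.
  by move: h; rewrite ltr_pXn2r // nnegrE ?normr_ge0 // ltW.
move=> cG; set p := lim G in cG; exists p => y.
apply: le_trans (hm y); rewrite leNgt; apply/negP => hp.
(* If [p] is not a minimizer, some level [a] below [Reg p] still exceeds [m] after adding the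
   quadratic term. For finite [Reg p] it is halfway between [Reg p] and the least admissible
   level. *)
have [a ha hap] : exists2 a : R, (a%:E < Reg p)%E &
    m < a + dot (p - z) (p - z) / (2 * gamma).
  move: (Rgt p) hp; rewrite /prox_obj; case: (Reg p) => [s||] // _.
    rewrite -EFinD lte_fin => hs.
    exists ((s + m - dot (p - z) (p - z) / (2 * gamma)) / 2); last lra.
    rewrite lte_fin; lra.
  move=> _; exists (m - dot (p - z) (p - z) / (2 * gamma) + 1); last lra.
  by rewrite ltey.
have [V nV hV] := Rlsc p a ha.
(* Near [p], [Reg] exceeds [a] and the quadratic term drops by less than e/2, so the objective stays
   above m + e/2. This contradicts that [sub (e / 2)] belongs to [G], which converges to [p]. *)
set e := a + dot (p - z) (p - z) / (2 * gamma) - m.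
have e0 : 0 < e by rewrite /e; lra.
have nW : nbhs p [set x | dot (p - z) (p - z) - e * gamma < dot (x - z) (x - z)].
  have := @continuous_dot_sub R d z p.
  move/cvgr_gt; apply; rewrite ltrBlDr ltrDl mulr_gt0 //.
have GV : G V by apply: cG.
have GW := cG _ nW.
have Ge : G (sub (e / 2)) by exists (e / 2) => //=; rewrite divr_gt0.
have [x [[/hV Vx Wx] ex]] := @filter_ex _ G GF _ (filterI (filterI GV GW) Ge).
move: Wx => /= Wx.
have : (dot (p - z) (p - z) - e * gamma) / (2 * gamma) < dot (x - z) (x - z) / (2 * gamma).
  by rewrite ltr_pM2r // invr_gt0 mulr_gt0.
have -> : (dot (p - z) (p - z) - e * gamma) / (2 * gamma)
    = dot (p - z) (p - z) / (2 * gamma) - e / 2 by field; lra.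
move: ex Vx; rewrite /sub /prox_obj /=; case: (Reg x) => [s||] //.
by rewrite -EFinD !lte_fin /e; lra.
Qed.

(** * Optimality condition and nonexpansiveness of the prox *)

Lemma prox_min (R : realType) (d : nat) (gamma : R)
    (Reg : 'rV[R]_d -> \bar R) (z p : 'rV[R]_d) :
  (forall y, (prox_obj gamma Reg z p <= prox_obj gamma Reg z y)%E) ->
  forall y, (prox_obj gamma Reg z (prox gamma Reg z) <= prox_obj gamma Reg z y)%E.
Proof.
move=> hp; have -> : prox gamma Reg z = argmin setT (prox_obj gamma Reg z).
  by congr argmin; apply/funext => y; rewrite sqr_enorm.
rewrite /argmin; set S := (X in get X).
have /getPex[_ h] : exists y, S y by exists p; split.
by move=> y; exact: h.
Qed.

(** First-order optimality: [p] is compared with t y + (1 - t) p, convexity bounds [Reg] there, and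
    dividing by [t] leaves 0 <= A + t B, from which A >= 0 follows. *)
Lemma prox_obj_min_VI (R : realType) (d : nat) (gamma : R)
    (Reg : 'rV[R]_d -> \bar R) (z p y : 'rV[R]_d) (rp ry : R) :
  0 < gamma -> (forall x, (-oo < Reg x)%E) -> econvex Reg ->
  (forall x, (prox_obj gamma Reg z p <= prox_obj gamma Reg z x)%E) ->
  Reg p = rp%:E -> Reg y = ry%:E ->
  dot (z - p) (y - p) / gamma <= ry - rp.
Proof.
move=> gamma0 Rgt Rconv pmin Ep Ey.
set A := ry - rp - dot (z - p) (y - p) / gamma.
set B := dot (y - p) (y - p) / (2 * gamma).
have B0 : 0 <= B by rewrite divr_ge0 ?dot_ge0 // mulr_ge0 // ltW.
suff h t : 0 < t <= 1 -> 0 <= A + t * B.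
  suff : 0 <= A by rewrite /A; lra.
  rewrite leNgt; apply/negP => A0.
  (* An explicit [t] replaces the limit t -> 0. The root -A/B may exceed 1 and fails for B = 0; the
     denominator B - A cures both and keeps A + t B negative. *)
  have t01 : 0 < - A / (B - A) <= 1.
    by rewrite divr_gt0 ?ler_pdivrMr ?mul1r; lra.
  have := h _ t01.
  have -> : A + - A / (B - A) * B = - (A ^+ 2 / (B - A)) by field; lra.
  by rewrite oppr_ge0 leNgt divr_gt0 //; [rewrite exprn_even_gt0 //=; lra|lra].
move=> /andP[t0 t1].
have t01 : 0 <= t <= 1 by rewrite ltW.
have := Rconv y p _ t01; have := pmin (t *: y + (1 - t) *: p)%R.
rewrite /prox_obj Ep Ey; set w := (_ *: _ + _)%R.
case: (Reg w) (Rgt w) => [rw||] // _.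
rewrite -?EFinM -?EFinD !lee_fin => hw hc.
have Ew : dot (w - z) (w - z) / (2 * gamma)
    = dot (p - z) (p - z) / (2 * gamma) - t * (dot (z - p) (y - p) / gamma) + t ^+ 2 * B.
  rewrite /w /B !dotE ![dot p y]dotC ![dot z _]dotC; field; lra.
rewrite Ew in hw.
rewrite -(pmulr_rge0 _ t0).
have -> : t * (A + t * B) = t * (ry - rp) - t * (dot (z - p) (y - p) / gamma) + t ^+ 2 * B.
  by rewrite /A; ring.
by move: hw hc; set Q := t * (_ / _); lra.
Qed.

(* Nonexpansiveness of the prox, compared with the fixed point
   xs = prox (xs - gamma F(xs)). *)
Lemma prox_dist_VI_solution (R : realType) (d : nat) (F : 'rV[R]_d -> 'rV[R]_d)
    (Reg : 'rV[R]_d -> \bar R) (gamma : R) (xs z : 'rV[R]_d) :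
  0 < gamma -> eproper Reg -> econvex Reg -> lower_semicontinuous Reg ->
  VI_solutions F Reg xs ->
  dot (prox gamma Reg z - xs) (prox gamma Reg z - xs)
    <= dot (z + gamma *: F xs - xs) (z + gamma *: F xs - xs).
Proof.
move=> gamma0 Rp Rconv Rlsc Rxs.
set p := prox gamma Reg z; set w := z + gamma *: F xs - xs.
have [p0 hp0] := exists_prox z gamma0 Rp Rconv Rlsc
  (fun y => VI_solution_minorant y Rp Rxs).
have pmin := prox_min hp0; rewrite -/p in pmin.
have Exs := fineK (VI_solution_fin Rp Rxs).
have : (Reg p < +oo)%E.
  have := pmin xs; rewrite /prox_obj -Exs -EFinD.
  by case: (Reg p) => [s||] //; rewrite ltry.
have Rgtp := Rp.1 p.
case Ep : (Reg p) Rgtp => [rp||] // _ _.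
have h1 := prox_obj_min_VI gamma0 Rp.1 Rconv pmin Ep (esym Exs).
have := VI_solution_minorant p Rp Rxs; rewrite Ep lee_fin => h2.
(* The optimality of [p] tested at [xs] and the VI of [xs] tested at [p] are added; the values of
   [Reg] cancel. *)
have h3 : dot (z - p) (xs - p) / gamma <= dot (F xs) (p - xs).
  by move: h2; rewrite dotNl; lra.
rewrite ler_pdivrMr // in h3.
(* Firm nonexpansiveness; expanding |w - (p - xs)|^2 >= 0 then yields the plain form. *)
have h4 : dot (p - xs) (p - xs) <= dot w (p - xs).
  rewrite -subr_ge0; have -> : dot w (p - xs) - dot (p - xs) (p - xs) =
     dot (F xs) (p - xs) * gamma - dot (z - p) (xs - p).
    rewrite /w !dotE; ring.
  by rewrite subr_ge0.
have := dot_ge0 (w - (p - xs)).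
have -> : dot (w - (p - xs)) (w - (p - xs))
    = dot w w - 2 * dot w (p - xs) + dot (p - xs) (p - xs).
  by move: (p - xs) (w) => v w'; rewrite !dotE (dotC v w'); ring.
by lra.
Qed.

(** * One-step contraction of the Lyapunov function *)

Lemma dot_addZdelta (R : realType) (d : nat) (c : R) (b : 'rV[R]_d) (j : 'I_d) :
  dot (b + c *: delta_mx 0 j) (b + c *: delta_mx 0 j)
    = dot b b + 2 * c * b 0 j + c ^+ 2.
Proof.
rewrite !dotDl !dotDr !dotZl !dotZr [dot (delta_mx 0 j) b]dotC !dot_delta.
by rewrite mxE !eqxx /=; ring.
Qed.

Definition sega_lyapunov (R : realType) (d : nat) (F : 'rV[R]_d -> 'rV[R]_d)
    (gamma : R) (xs : 'rV[R]_d) (s : 'rV[R]_d * 'rV[R]_d) : R :=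
  dot (s.1 - xs) (s.1 - xs)
  + 4 * d%:R ^+ 2 * gamma ^+ 2 * dot (s.2 - F xs) (s.2 - F xs).

Lemma sega_lyapunov_ge0 (R : realType) (d : nat) (F : 'rV[R]_d -> 'rV[R]_d)
    (gamma : R) (xs : 'rV[R]_d) (s : 'rV[R]_d * 'rV[R]_d) :
  0 <= sega_lyapunov F gamma xs s.
Proof.
apply: addr_ge0; first exact: dot_ge0.
by rewrite mulr_ge0 ?dot_ge0 // mulr_ge0 ?sqr_ge0 // mulr_ge0 ?sqr_ge0.
Qed.

(* The bound keeps the products of jth coordinates apart, so that summing over j
   turns them into inner products. *)
Lemma sega_lyapunov_step (R : realType) (d : nat) (F : 'rV[R]_d -> 'rV[R]_d)
    (Reg : 'rV[R]_d -> \bar R) (gamma : R) (xs x h : 'rV[R]_d) (j : 'I_d) :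
  let u := x - xs in let a := F x - F xs in let b := h - F xs in
  let D := d%:R : R in
  0 < gamma -> eproper Reg -> econvex Reg -> lower_semicontinuous Reg ->
  VI_solutions F Reg xs ->
  sega_lyapunov F gamma xs (sega_step F Reg gamma (x, h) j) <=
    dot u u + gamma ^+ 2 * dot b b - 2 * gamma * dot u b
    + 4 * D ^+ 2 * gamma ^+ 2 * dot b b
    + ((2 * D * gamma ^+ 2 + 8 * D ^+ 2 * gamma ^+ 2) * ((a - b) 0 j * b 0 j)
       - 2 * D * gamma * ((a - b) 0 j * u 0 j)
       + (gamma ^+ 2 * D ^+ 2 + 4 * D ^+ 2 * gamma ^+ 2)
         * ((a - b) 0 j * (a - b) 0 j)).
Proof.
move=> u a b D gamma0 Rp Rconv Rlsc Rxs; rewrite /sega_lyapunov /sega_step /= -/D.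
set c := F x 0 j - h 0 j.
have Ec : (a - b) 0 j = c by rewrite /a /b /c !mxE; ring.
have := prox_dist_VI_solution (x - gamma *: ((D * c) *: delta_mx 0 j + h))
   gamma0 Rp Rconv Rlsc Rxs => /=.
set p := prox _ _ _; set w := (X in _ <= dot X X) => hp.
(* Since g - F(xs) = b + D c e_j, the sampled coordinate enters only through a multiple of e_j, and
   [dot_addZdelta] applies. *)
have Ew : w = (u - gamma *: b) + (- gamma * (D * c)) *: delta_mx 0 j.
  by apply/rowP => i; rewrite /w /u /b !mxE; ring.
have -> : h + c *: delta_mx 0 j - F xs = b + c *: delta_mx 0 j.
  by rewrite /b addrAC.
apply: le_trans (lerD hp (lexx _)) _.
rewrite Ew !dot_addZdelta Ec.
have -> : (u - gamma *: b) 0 j = u 0 j - gamma * b 0 j by rewrite !mxE.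
move: (u) (b) => u' b'; rewrite !dotE (dotC b' u').
by rewrite le_eqVlt; apply/orP; left; apply/eqP; ring.
Qed.

(** The scalar core, with X = |u|^2, A = |a|^2, B = |b|^2, C = <a, b> and p = <a, u>. Both sides
    carry a factor D because the descent is stated for the sum over coordinates, not the mean. *)
Lemma sega_rate_ineq (R : realType) (D mu l gamma X A B C p : R) :
  1 <= D -> 0 < l -> 0 < gamma -> gamma <= 1 / (6 * D * l) ->
  0 <= X -> 0 <= A -> 0 <= B -> 0 <= A + 2 * C + B ->
  mu * X <= p -> A <= l * p ->
  D * X - 2 * D * gamma * p
    + gamma ^+ 2 * (D ^+ 2 * (A - 2 * C + B) + 2 * D * (C - B) + D * B)
    + 4 * D ^+ 2 * gamma ^+ 2 * (D * B - B + A)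
  <= D * ((1 - Num.min (gamma * mu) (1 / (2 * D))) * (X + 4 * D ^+ 2 * gamma ^+ 2 * B)).
Proof.
move=> D1 l0 gamma0 hgamma X0 A0 B0 ACB hX hA.
have D0 : 0 < D by lra.
(* The minimum is bounded by gamma mu on the X term and by 1/(2D) on the B term. *)
have rhs : D * X - D * gamma * p + 4 * D ^+ 2 * gamma ^+ 2 * B * (D - 2^-1) <=
   D * ((1 - Num.min (gamma * mu) (1 / (2 * D))) * (X + 4 * D ^+ 2 * gamma ^+ 2 * B)).
  set r := Num.min _ _.
  have r1 : r <= gamma * mu by rewrite ge_min lexx.
  have r2 : r <= 1 / (2 * D) by rewrite ge_min lexx orbT.
  have h1 : r * X <= gamma * p.
    apply: le_trans (ler_wpM2r X0 r1) _.
    by rewrite -mulrA ler_pM2l.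
  have h2 : D * r <= 2^-1.
    have -> : 2^-1 = D * (1 / (2 * D)) by field; lra.
    by rewrite ler_pM2l.
  have G0 : 0 <= 4 * D ^+ 2 * gamma ^+ 2 * B.
    by rewrite mulr_ge0 // mulr_ge0 ?sqr_ge0 // mulr_ge0 ?sqr_ge0.
  move: G0; set G := 4 * _ * _ * B => G0.
  have h3 := ler_wpM2l G0 h2.
  have h4 := ler_wpM2l (ltW D0) h1.
  have -> : D * ((1 - r) * (X + G)) = D * X - D * (r * X) + G * D - G * (D * r) by ring.
  lra.
apply: le_trans rhs.
have g6 : 6 * D * l * gamma <= 1.
  move: hgamma; rewrite ler_pdivlMr; last by rewrite !mulr_gt0.
  by rewrite mulrC.
have p0 : 0 <= p by rewrite -(pmulr_rge0 _ l0); lra.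
have gA : 6 * D * gamma ^+ 2 * A <= gamma * p.
  have g0 : 0 <= 6 * D * gamma ^+ 2 by rewrite mulr_ge0 ?sqr_ge0 // mulr_ge0 // ltW.
  apply: le_trans (ler_wpM2l g0 hA) _.
  have -> : 6 * D * gamma ^+ 2 * (l * p) = (6 * D * l * gamma) * (gamma * p) by ring.
  by rewrite ler_piMl // mulr_ge0 // ltW.
have DgA := ler_wpM2l (ltW D0) gA.
(* This is exactly what remains once 6 D gamma^2 A is charged to gamma p; the cross term C is
   absorbed in A + 2C + B = |a + b|^2. *)
have K : 0 <= D * gamma ^+ 2 * ((D - 1) * (A + 2 * C + B) + A + 2 * B).
  apply: mulr_ge0; first by rewrite mulr_ge0 ?sqr_ge0 // ltW.
  have : 0 <= (D - 1) * (A + 2 * C + B) by rewrite mulr_ge0 // subr_ge0.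
  lra.
rewrite -subr_ge0.
set lhs := (X in 0 <= X).
have -> : lhs = (D * (gamma * p) - D * (6 * D * gamma ^+ 2 * A))
   + D * gamma ^+ 2 * ((D - 1) * (A + 2 * C + B) + A + 2 * B).
  by rewrite /lhs; field.
by rewrite addr_ge0 // subr_ge0.
Qed.

Lemma sega_lyapunov_descent (R : realType) (d : nat) (F : 'rV[R]_d -> 'rV[R]_d)
    (Reg : 'rV[R]_d -> \bar R) (mu l gamma : R) (xs : 'rV[R]_d)
    (s : 'rV[R]_d * 'rV[R]_d) :
  (0 < d)%N -> eproper Reg -> econvex Reg -> lower_semicontinuous Reg ->
  0 < l -> 0 < gamma -> gamma <= 1 / (6 * d%:R * l) ->
  quasi_strongly_monotone mu F (VI_solutions F Reg) ->
  star_cocoercive l F (VI_solutions F Reg) ->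
  VI_solutions F Reg = [set xs] ->
  \sum_(j < d) sega_lyapunov F gamma xs (sega_step F Reg gamma s j)
    <= d%:R * ((1 - Num.min (gamma * mu) (1 / (2 * d%:R)))
               * sega_lyapunov F gamma xs s).
Proof.
case: s => x h d0 Rp Rconv Rlsc l0 gamma0 hgamma hqsm hcoco hxs.
(* Because the solution set is a singleton, the projection in both assumptions on [F] is [xs]
   itself. *)
have Rxs : VI_solutions F Reg xs by rewrite hxs.
have := hqsm x; have := hcoco x; rewrite hxs euclid_proj_set1 /= !sqr_enorm.
move=> hA hX.
apply: le_trans (ler_sum _ (fun j _ => sega_lyapunov_step x h j gamma0 Rp Rconv Rlsc Rxs)) _.
set u := x - xs in hA hX *; set a := F x - F xs in hA hX *; set b := h - F xs.
have D1 : 1 <= d%:R :> R by rewrite ler1n.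
have := sega_rate_ineq D1 l0 gamma0 hgamma (dot_ge0 u) (dot_ge0 a) (dot_ge0 b) _ hX hA.
move=> /(_ (dot a b)) rate.
rewrite /sega_lyapunov /= -/u -/b.
apply: le_trans (rate _); last first.
  move: (a) (b) => a' b'; have := dot_ge0 (a' + b'); rewrite !dotE (dotC b' a'); lra.
rewrite big_split /= sumr_const card_ord -[X in X <= _]addrC.
rewrite big_split /= sumrB -!mulr_sumr.
rewrite -/(dot (a - b) b) -/(dot (a - b) u) -/(dot (a - b) (a - b)).
rewrite -mulr_natl.
move: (u) (a) (b) => u' a' b'; rewrite !dotE (dotC b' a') (dotC b' u').
by rewrite le_eqVlt; apply/orP; left; apply/eqP; ring.
Qed.

(** * Iterations driven by independent uniform indices *)

(** As a fold over the sampled indices, the method becomes an instance of the abstract iteration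
    treated below. *)
Lemma sega_is_iteration (R : realType) (d : nat) (F : 'rV[R]_d -> 'rV[R]_d)
    (Reg : 'rV[R]_d -> \bar R) (gamma : R) (x0 h0 : 'rV[R]_d) (j : nat -> 'I_d)
    (k : nat) :
  sega F Reg gamma x0 h0 j k = foldl (sega_step F Reg gamma) (x0, h0) (mkseq j k).
Proof. by elim: k => [|k IH] //; rewrite mkseqS foldl_rcons -IH. Qed.

Section iid_driven_iteration.
Context (disp : measure_display) (T : measurableType disp) (R : realType).
Context (P : probability T R) (d : nat) (J : nat -> T -> 'I_d).
Hypothesis hJ : iid_uniform P J.

(** Integrals over these sets stand in for conditional expectations: the nonempty ones are the atoms
    of the sigma-algebra of the first [size s] indices. *)
Definition cylinder (s : seq 'I_d) : set T := [set w | mkseq (J ^~ w) (size s) = s].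

Lemma cylinder_nil : cylinder [::] = setT.
Proof. by apply/seteqP; split. Qed.

(** The form to which mutual independence applies; [i0] is only a default for [nth]. *)
Lemma cylinder_bigcap (i0 : 'I_d) (s : seq 'I_d) :
  cylinder s = \bigcap_(i in [set` iota 0 (size s)]) (J i @^-1` [set nth i0 s i]).
Proof.
apply/seteqP; split=> w /=.
  move=> E i /=; rewrite mem_iota /= add0n => hi.
  by rewrite -[in RHS]E nth_mkseq.
move=> h; apply: (@eq_from_nth _ i0); rewrite size_mkseq // => i hi.
by rewrite nth_mkseq //; apply: (h i); rewrite /= mem_iota.
Qed.

Lemma measurable_cylinder (s : seq 'I_d) : measurable (cylinder s).
Proof.
case: s => [|i0 s]; first by rewrite cylinder_nil.
rewrite (cylinder_bigcap i0); apply: fin_bigcap_measurable => [|i _].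
  exact: finite_seq.
by case: hJ => mJ _ _; exact: mJ.
Qed.

Lemma probability_cylinder (s : seq 'I_d) :
  P (cylinder s) = (d%:R^-1 ^+ size s)%:E.
Proof.
case: s => [|i0 s]; first by rewrite cylinder_nil probability_setT.
rewrite (cylinder_bigcap i0); case: hJ => _ unif ->; last exact: iota_uniq.
rewrite (eq_bigr (fun=> (d%:R^-1)%:E)) => [|i _]; last exact: unif.
by rewrite prodEFin big_const_seq count_predT size_iota iter_mulr mulr1.
Qed.

Lemma cylinder_rcons (s : seq 'I_d) :
  cylinder s = \big[setU/set0]_(j <- enum 'I_d) cylinder (rcons s j).
Proof.
rewrite -bigcup_seq; apply/seteqP; split=> [w /= E|w [j _]] /=.
  exists (J (size s) w); first by rewrite /= mem_enum.
  by rewrite /cylinder /= size_rcons mkseqS E.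
by rewrite /cylinder /= size_rcons mkseqS => /rcons_inj[].
Qed.

Variables (S : Type) (step : S -> 'I_d -> S) (s0 : S).

Let state k w := foldl step s0 (mkseq (J ^~ w) k).

(** The state at step [k] is determined by [k] indices from a finite set, so every preimage is a
    finite union of cylinders. *)
Lemma measurable_state (k : nat) (A : set S) : measurable (state k @^-1` A).
Proof.
have -> : state k @^-1` A =
    \bigcup_(t in [set t : k.-tuple 'I_d | A (foldl step s0 t)]) cylinder t.
  apply/seteqP; split=> [w /= Aw|w [t /= At]].
    exists [tuple of mkseq (J ^~ w) k] => //=.
    by rewrite /cylinder /= size_mkseq.
  by rewrite /cylinder /= size_tuple /state => ->.
apply: fin_bigcup_measurable => [|t _]; first exact: finite_finset.
exact: measurable_cylinder.
Qed.

Lemma measurable_fun_state (V : S -> R) (k : nat) :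
  measurable_fun setT (fun w => V (state k w)).
Proof.
move=> _ Y _; rewrite setTI.
exact: (measurable_state k (V @^-1` Y)).
Qed.

(* Conditionally on a cylinder the next index is uniform, so a one-step
   contraction averaged over the index iterates, from the last step backwards. *)
Lemma integral_cylinder_le (V : S -> R) (rho : R) :
  (0 < d)%N -> (forall s, 0 <= V s) -> 0 <= rho ->
  (forall s, \sum_(j < d) V (step s j) <= d%:R * (rho * V s)) ->
  forall n s,
  (\int[P]_(w in cylinder s) (V (state (size s + n) w))%:E
     <= (rho ^+ n * V (foldl step s0 s) * d%:R^-1 ^+ size s)%:E)%E.
Proof.
move=> d0 V0 rho0 contr; elim=> [|n IH] s.
  (* With no step left, the state is constant on the cylinder. *)
  rewrite addn0 (eq_integral (cst (V (foldl step s0 s))%:E)); last first.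
    by move=> w; rewrite inE /cylinder /state /= => ->.
  rewrite integral_cst; last exact: measurable_cylinder.
  by rewrite [X in (_ * X)%E](probability_cylinder s) -EFinM expr0 mul1r.
(* The cylinder is split by the next index. Each piece carries an extra factor 1/d, which cancels
   the [d] in the contraction hypothesis. *)
rewrite cylinder_rcons ge0_integral_bigsetU //=; last first.
- by move=> w _; rewrite lee_fin.
- apply/measurable_EFinP; apply: measurable_funS (measurable_fun_state V _) => //.
- move=> i j _ _ [w []]; rewrite /cylinder /= !size_rcons => -> /rcons_inj[].
  by [].
- exact: enum_uniq.
- by move=> j; exact: measurable_cylinder.
apply: (@le_trans _ _ (\sum_(j <- enum 'I_d)
    (rho ^+ n * V (step (foldl step s0 s) j) * d%:R^-1 ^+ (size s).+1)%:E)%E).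
  apply: lee_sum => j _; have := IH (rcons s j).
  by rewrite size_rcons addSnnS foldl_rcons.
rewrite sumEFin lee_fin big_enum /= -mulr_suml -mulr_sumr.
rewrite [_ ^+ (size s).+1]exprS [X in X <= _]mulrA.
have D0 : 0 < d%:R :> R by rewrite ltr0n.
rewrite ler_wpM2r ?exprn_ge0 ?invr_ge0 //.
rewrite ler_pdivrMr //.
apply: le_trans (ler_wpM2l (exprn_ge0 _ rho0) (contr _)) _.
by rewrite exprSr le_eqVlt; apply/orP; left; apply/eqP; ring.
Qed.

Lemma expectation_iteration_le (V : S -> R) (rho : R) (k : nat) :
  (0 < d)%N -> (forall s, 0 <= V s) -> 0 <= rho ->
  (forall s, \sum_(j < d) V (step s j) <= d%:R * (rho * V s)) ->
  ('E_P[(fun w => V (state k w))%R] <= (rho ^+ k * V s0)%:E)%E.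
Proof.
move=> d0 V0 rho0 contr; rewrite unlock.
have := integral_cylinder_le d0 V0 rho0 contr k [::].
by rewrite cylinder_nil add0n expr0 mulr1.
Qed.

End iid_driven_iteration.

(** * Convergence rate of SEGA-SGDA *)

Unset Implicit Arguments.

Theorem theoremH10 (R : realType) (d : nat) (hd : (0 < d)%N)
    (F : 'rV[R]_d -> 'rV[R]_d) (Reg : 'rV[R]_d -> \bar R)
    (hproper : eproper Reg) (hlsc : lower_semicontinuous Reg)
    (hconvex : econvex Reg)
    (mu l gamma : R) (hmu : 0 < mu) (hl : 0 < l)
    (hqsm : quasi_strongly_monotone mu F (VI_solutions F Reg))
    (hcoco : star_cocoercive l F (VI_solutions F Reg))
    (xs : 'rV[R]_d) (hxs : VI_solutions F Reg = [set xs])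
    (hgamma0 : 0 < gamma) (hgamma : gamma <= 1 / (6 * d%:R * l))
    (disp : measure_display) (T : measurableType disp) (P : probability T R)
    (J : nat -> T -> 'I_d) (hJ : iid_uniform P J)
    (x0 : 'rV[R]_d) (k : nat) :
  let h0 : 'rV[R]_d := 0 in
  let x k w := (sega F Reg gamma x0 h0 (fun i => J i w) k).1 in
  let sigma0_sq := enorm (h0 - F xs) ^+ 2 in
  let V0 := enorm (x0 - xs) ^+ 2 + 4 * d%:R ^+ 2 * gamma ^+ 2 * sigma0_sq in
  ('E_P[(fun w => enorm (x k w - xs) ^+ 2)%R]
     <= ((1 - Num.min (gamma * mu) (1 / (2 * d%:R))) ^+ k * V0)%:E)%E.
Proof.
cbv zeta.
set rho := 1 - Num.min _ _.
have rho0 : 0 <= rho.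
  have D1 : 1 <= d%:R :> R by rewrite ler1n.
  have : Num.min (gamma * mu) (1 / (2 * d%:R)) <= 1 / (2 * d%:R) :> R.
    by rewrite ge_min lexx orbT.
  have : 1 / (2 * d%:R) <= 1 :> R by rewrite ler_pdivrMr; lra.
  rewrite /rho; lra.
have := expectation_iteration_le hJ (x0, 0) k hd
  (sega_lyapunov_ge0 F gamma xs) rho0
  (fun s => sega_lyapunov_descent s hd hproper hconvex hlsc hl hgamma0 hgamma
              hqsm hcoco hxs).
rewrite {2}/sega_lyapunov /= -!sqr_enorm.
(* The squared distance is one of the two nonnegative summands of the Lyapunov function, whose
   expectation is already bounded. *)
apply: le_trans; rewrite unlock; apply: ge0_le_integral => //.
- by move=> w _; rewrite lee_fin sqr_ge0.
- apply/measurable_EFinP.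
  under eq_fun do rewrite sega_is_iteration.
  exact: (measurable_fun_state hJ (sega_step F Reg gamma) (x0, 0)
    (fun s => enorm (s.1 - xs) ^+ 2)).
- apply/measurable_EFinP.
  exact: (measurable_fun_state hJ (sega_step F Reg gamma) (x0, 0)
    (sega_lyapunov F gamma xs)).
move=> w _; rewrite lee_fin sqr_enorm sega_is_iteration lerDl.
by rewrite mulr_ge0 ?dot_ge0 // mulr_ge0 ?sqr_ge0 // mulr_ge0 ?sqr_ge0.
Qed.
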